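(* The error bounds for the first and second order expansions of solutions of the heat equation are asymptotically sharp in the following sense. For $m\in\{1,2\}$, there are smooth bounded initial data $g:\mathbb{R}^N\to\mathbb{R}$ (with bounded derivatives) such that, with $u$ the solution of $\partial_tu=\sum_{k=1}^N\lambda_k\partial_{z_k}^2u$ on $\mathbb{R}^N\times(0,T)$, $u(\cdot,0)=g$, and $u_{r,m}$ its expansion of order $m$ around $\lambda^0=(\lambda_1,\dots,\lambda_r,0,\dots,0)$, $$\|u(\cdot,t)-u_{r,m}(\cdot,t)\|_\infty=t^{m+1}\sum_{\substack{|\alpha|=m+1\\ \alpha_i\in\{0,1\}}}(\lambda-\lambda^0)^\alpha\,\|D^{2\alpha}g\|_\infty+o\big(t^{m+1}|\lambda-\lambda^0|^{m+1}\big)\qquad\text{as } t\to0 .$$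
   Context: Here $\lambda_1\ge\dots\ge\lambda_N\ge0$ and $0\le r\le N$; $\alpha=(\alpha_1,\dots,\alpha_N)$ are multi-indices, $|\alpha|=\sum_i\alpha_i$, $(\lambda-\lambda^0)^\alpha=\prod_i(\lambda_i-\lambda^0_i)^{\alpha_i}$, $D^{2\alpha}g=\partial_{z_1}^{2\alpha_1}\cdots\partial_{z_N}^{2\alpha_N}g$, and $\|\cdot\|_\infty$ is the supremum norm over $\mathbb{R}^N$. For $\nu\subseteq\{1,\dots,N\}$, $u^\nu$ is the solution of $\partial_tu^\nu=\sum_{k\in\nu}\lambda_k\partial_{z_k}^2u^\nu$, $u^\nu(\cdot,0)=g$ (given by convolution of $g$ with the Gaussian heat kernel in the coordinates $k\in\nu$), and $u=u^{\{1,\dots,N\}}$. The expansions are $$u_{r,1}=(1+r-N)u^{\{1,\dots,r\}}+\sum_{k=r+1}^Nu^{\{1,\dots,r,k\}},$$ $$u_{r,2}=\Big(1+\tfrac{(N-r)(N-r-3)}2\Big)u^{\{1,\dots,r\}}+(2-(N-r))\sum_{k=r+1}^Nu^{\{1,\dots,r,k\}}+\sum_{r<k<l\le N}u^{\{1,\dots,r,k,l\}}.$$ *)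

(* Defs.v *)
From HB Require Import structures.
From mathcomp Require Import all_boot all_order all_algebra.
From mathcomp Require Import all_classical all_reals all_analysis.
Set Implicit Arguments.
Unset Strict Implicit.
Unset Printing Implicit Defensive.
Import Order.TTheory GRing.Theory Num.Theory.
Import numFieldNormedType.Exports.
Local Open Scope classical_set_scope.
Local Open Scope ring_scope.

(* Points of R^N are row vectors.  Coordinates are numbered from 0, so the
   coordinates 1, ..., r of the usual numbering are the i : 'I_N with i < r. *)

Section HeatExpansion.
Variables (R : realType) (N : nat).
Implicit Types (f g : 'rV[R]_N -> R) (lam z : 'rV[R]_N) (nu : {set 'I_N}).
Implicit Types (u : {set 'I_N} -> R -> 'rV[R]_N -> R).

(* This is the genuine supremum only for bounded f: sup is 0 on unbounded
   sets. *)
Definition supnorm f : R := sup [set `|f z| | z in [set: 'rV[R]_N]].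

Definition eucl_norm (v : 'rV[R]_N) : R := Num.sqrt (\sum_i v 0 i ^+ 2).

Definition partial (i : 'I_N) f : 'rV[R]_N -> R :=
  fun z => 'D_(delta_mx 0 i) f z.

(* partials [:: i1; ...; in] f = d_i1 (... (d_in f)) *)
Definition partials (s : seq 'I_N) f : 'rV[R]_N -> R := foldr partial f s.

(* Every iterated partial derivative, in any order and including f itself,
   exists, is continuous and is bounded. *)
Definition smooth_bounded f : Prop :=
  forall s : seq 'I_N,
    [/\ forall i z, derivable (partials s f) z (delta_mx 0 i),
        continuous (partials s f)
      & bounded_fun (partials s f)].

Definition mderiv (a : 'I_N -> nat) f : 'rV[R]_N -> R :=
  foldr (fun i h => iter (a i) (partial i) h) f (enum 'I_N).

Definition mpow (v : 'rV[R]_N) (a : 'I_N -> nat) : R := \prod_i v 0 i ^+ a i.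

Definition heat_kernel (s x : R) : R :=
  (Num.sqrt (4 * pi * s))^-1 * expR (- (x ^+ 2 / (4 * s))).

Definition set_coord z (k : 'I_N) (y : R) : 'rV[R]_N :=
  \row_j (if j == k then y else z 0 j).

(* Convolution in coordinate k with the heat kernel at time s; at s = 0 the
   kernel degenerates to the Dirac mass, that is, to the identity. *)
Definition heat_conv (k : 'I_N) (s : R) f : 'rV[R]_N -> R := fun z =>
  if 0 < s then
    \int[lebesgue_measure]_(y in [set: R])
      (heat_kernel s (z 0 k - y) * f (set_coord z k y))
  else f z.

(* The N-dimensional kernel in the coordinates of nu is the product of the
   one-dimensional ones, so the convolution is an iterated integral. *)
Definition heat_flow lam g nu (t : R) : 'rV[R]_N -> R :=
  foldr (fun k h => heat_conv k (lam 0 k * t) h) g (enum nu).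

Definition heat_solution (T : R) lam nu g (v : R -> 'rV[R]_N -> R) : Prop :=
  let QT := [set p : R * 'rV[R]_N | 0 <= p.1 < T] in
  [/\ v 0 = g,
      {within QT, continuous (fun p : R * 'rV[R]_N => v p.1 p.2)},
      [bounded v p.1 p.2 | p in QT]
    & forall (t : R) z, 0 < t < T ->
      [/\ derivable (fun s : R => v s z) t 1,
          forall k, k \in nu ->
            derivable (v t) z (delta_mx 0 k) /\
            derivable (partial k (v t)) z (delta_mx 0 k)
        & derive1 (fun s : R => v s z) t =
          \sum_(k in nu) lam 0 k * partial k (partial k (v t)) z]].

Definition lam0 (r : nat) lam : 'rV[R]_N :=
  \row_i (if (i < r)%N then lam 0 i else 0).

Definition head_set (r : nat) : {set 'I_N} := [set i : 'I_N | (i < r)%N]%SET.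

Definition expansion1 (r : nat) u (t : R) z : R :=
  (1 + r%:R - N%:R) * u (head_set r) t z
  + \sum_(k < N | (r <= k)%N) u (k |: head_set r)%SET t z.

Definition expansion2 (r : nat) u (t : R) z : R :=
  (1 + (N%:R - r%:R) * (N%:R - r%:R - 3) / 2) * u (head_set r) t z
  + (2 - (N%:R - r%:R)) * \sum_(k < N | (r <= k)%N) u (k |: head_set r)%SET t z
  + \sum_(k < N | (r <= k)%N) \sum_(l < N | (k < l)%N)
      u (k |: (l |: head_set r))%SET t z.

(* Only m = 1 and m = 2 are meaningful. *)
Definition expansion (m r : nat) u : R -> 'rV[R]_N -> R :=
  if m == 1%N then expansion1 r u else expansion2 r u.

End HeatExpansion.

(* Main.v *)
Require Import Defs.
From HB Require Import structures.
From mathcomp Require Import all_boot all_order all_algebra.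
From mathcomp Require Import all_classical all_reals all_analysis.
From mathcomp Require Import measurable_realfun ring lra.
Set Implicit Arguments.
Unset Strict Implicit.
Unset Printing Implicit Defensive.
Import Order.TTheory GRing.Theory Num.Theory.
Import numFieldNormedType.Exports.
Local Open Scope classical_set_scope.
Local Open Scope ring_scope.

(** The initial datum is the product of cosines
    [g z = \prod_i cos (z 0 i)].  Each coordinate factor is an eigenfunction
    of the one-dimensional Laplacian with eigenvalue [-1], so convolution with
    the heat kernel in coordinate [k] for a time [s] multiplies [g] by
    [expR (- s)] ([heat_kernel_cos], [heat_conv_cosprod]), and [u nu t] is [g]
    times the exponential of [- t] times the sum of the [lam 0 k], [k] in [nu].
    Adding phases to the cosines gives a family closed under differentiation,
    all of whose members have supremum norm 1; this gives smoothness and all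
    the norms of derivatives.

    The error is therefore a scalar multiple of [g].  Put
    [y k = expR (- t * (lam - lam0) k) - 1].  The full solution has the
    coefficient [H * \prod_k (1 + y k)], where [H] is the decay due to the first
    [r] coordinates, and the expansion of order [m] is designed to reproduce the
    part of degree at most [m] in [y] of this product.  The error
    coefficient is thus [H] times the sum of the elementary symmetric
    polynomials of degree greater than [m] in [y] ([expansion_error]).  As
    [y k / t] tends to [- (lam - lam0) k] and [H] to 1, the error
    divided by [t ^+ m.+1] tends to [(-1) ^+ m.+1] times the elementary
    symmetric polynomial of degree [m.+1] in [lam - lam0]
    ([error_coef_cvg]).  The absolute value of this limit is the sum in the
    statement.  The remainder must be compared with a multiple of
    [eucl_norm (lam - lam0) ^+ m.+1]: if this constant is nonzero the limit
    suffices, and if it is zero the error vanishes identically.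

    The analytic input is the Fourier transform of the heat kernel.  The
    integral of the kernel against [cos (a * (y - x) + c)], as a function
    of the frequency [a], is differentiated under the integral sign; an
    integration by parts turns the result into the differential equation
    [J' a = - 2 s a J a]. *)

(** * The Fourier transform of the heat kernel *)

Section GaussianCosine.
Context {R : realType}.
Notation mu := (@lebesgue_measure R).
Implicit Types (a c s x y : R).

(** The fundamental theorem of calculus on the whole line, for an
    antiderivative that vanishes at infinity. *)
Lemma Rintegral_derivative_eq0 (F f : R -> R) x :
  (forall y, is_derive y 1 F (f y)) -> continuous f ->
  mu.-integrable setT (EFin \o f) ->
  F (x - n%:R) @[n --> \oo] --> 0 -> F (x + n%:R) @[n --> \oo] --> 0 ->
  \int[mu]_(y in [set: R]) f y = 0.
Proof.
move=> dF cf intf Fm Fp; rewrite /Rintegral.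
pose D n := `[x - n%:R, x + n%:R]%classic : set R.
pose h n := (EFin \o f) \_ (D n).
have lim_h : (\int[mu]_y h n y)%E @[n --> \oo] --> (\int[mu]_y (f y)%:E)%E.
  have intaf : mu.-integrable setT (fun y => `|(f y)%:E|%E).
    exact: integrable_abse.
  apply: (@dominated_cvg _ _ R mu setT _ h (EFin \o f) _ _ _ _ intaf) => //.
  - move=> n; apply/(measurable_restrictT _ (measurable_itv _)).
    by apply: measurable_funTS; exact: measurable_int intf.
  - move=> y _; apply: cvg_near_cst; near=> n.
    rewrite /h patchE mem_set// /D /= in_itv/=.
    have : `|y - x| <= n%:R by near: n; exact: nbhs_infty_ger.
    by rewrite ler_norml => /andP[? ?]; apply/andP; split; lra.
  - move=> n y _; rewrite /h patchE; case: ifP => _ //.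
    by rewrite abse0 abse_ge0.
(* The index is shifted so that the interval is nondegenerate. *)
have int_h n : (\int[mu]_y h n.+1 y)%E = (F (x + n.+1%:R) - F (x - n.+1%:R))%:E.
  have n0 : 0 < n.+1%:R :> R by [].
  rewrite -integral_mkcond (@continuous_FTC2 _ f F) ?EFinB//.
  - by lra.
  - exact: continuous_subspaceT.
  - have cF : continuous F.
      by move=> y; apply/differentiable_continuous/derivable1_diffP.
    split=> //; first by exact/cvg_at_right_filter/cF.
    by exact/cvg_at_left_filter/cF.
  - by move=> y _; rewrite derive1E derive_val.
have lim0 : (\int[mu]_y h n.+1 y)%E @[n --> \oo] --> 0%:E.
  rewrite (_ : (fun n => _) =
      EFin \o (fun n => F (x + n.+1%:R) - F (x - n.+1%:R))).
    apply: cvg_EFin; first exact: nearW.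
    rewrite /= -(subr0 0).
    by apply: cvgB; [move: Fp|move: Fm]; rewrite -cvg_shiftS.
  exact/funext.
have lim_hS : (\int[mu]_y h n.+1 y)%E @[n --> \oo] --> (\int[mu]_y (f y)%:E)%E.
  by have := lim_h; rewrite -cvg_shiftS.
by have := cvg_unique _ lim_hS lim0 => /(_ (@ereal_hausdorff R)) ->.
Unshelve. all: by end_near. Qed.
End GaussianCosine.

Section HeatKernel.
Context {R : realType}.
Notation mu := (@lebesgue_measure R).
Implicit Types (a c s x y : R).

(** The heat kernel is a Gaussian density of variance [2 s]. *)
Lemma heat_kernel_normal s x y :
  0 < s -> heat_kernel s (x - y) = normal_pdf x (Num.sqrt (2 * s)) y.
Proof.
move=> s0; have s20 : 0 <= 2 * s by lra.
rewrite normal_pdfE; last by rewrite gt_eqF// sqrtr_gt0; lra.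
rewrite /normal_peak /normal_fun /heat_kernel sqr_sqrtr//.
congr ((Num.sqrt _)^-1 * expR _); first by rewrite -mulr_natr; ring.
by rewrite -mulr_natr; field; lra.
Qed.

Lemma heat_kernel_ge0 s y : 0 <= heat_kernel s y.
Proof. by rewrite mulr_ge0 ?invr_ge0 ?sqrtr_ge0 ?expR_ge0. Qed.

Lemma integrable_heat_kernel s x : 0 < s ->
  mu.-integrable setT (fun y => (heat_kernel s (x - y))%:E).
Proof.
move=> s0; under eq_fun do rewrite heat_kernel_normal//.
exact: integrable_normal_pdf.
Qed.

Lemma Rintegral_heat_kernel s x : 0 < s ->
  \int[mu]_(y in setT) heat_kernel s (x - y) = 1.
Proof.
move=> s0; rewrite /Rintegral.
under eq_integral do rewrite heat_kernel_normal//.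
by rewrite integral_normal_pdf.
Qed.

Lemma is_derive_heat_kernel s x y : 0 < s ->
  is_derive y 1 (fun y => heat_kernel s (x - y))
    ((x - y) / (2 * s) * heat_kernel s (x - y)).
Proof.
move=> s0; rewrite /heat_kernel; apply: is_derive_eq.
rewrite /GRing.scale/=; field.
by rewrite !gt_eqF// sqrtr_gt0 !mulr_gt0// pi_gt0.
Qed.

(** A factor [`|y|] is absorbed by a Gaussian of twice the variance. *)
Lemma heat_kernel_moment s y : 0 < s ->
  `|y| * heat_kernel s y <= Num.sqrt 2 * (1 + 8 * s) * heat_kernel (2 * s) y.
Proof.
move=> s0; rewrite /heat_kernel.
have -> : 4 * pi * (2 * s) = 2 * (4 * pi * s) by ring.
rewrite (@sqrtrM _ 2)// (invfM (Num.sqrt 2)).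
set k := (Num.sqrt (4 * pi * s))^-1.
have k0 : 0 <= k by rewrite invr_ge0 sqrtr_ge0.
have q0 : 0 < Num.sqrt 2 :> R by rewrite sqrtr_gt0.
rewrite (_ : _ * (1 + 8 * s) * _ =
   k * ((1 + 8 * s) * expR (- (y ^+ 2 / (4 * (2 * s)))))); last first.
  by field; rewrite gt_eqF.
rewrite mulrCA ler_wpM2l//.
(* With this [v], the kernel on the left is [k * expR (- (2 * v))], and
   [`|y| <= 1 + y ^+ 2 = 1 + 8 * s * v <= (1 + 8 * s) * expR v]. *)
set v := y ^+ 2 / (4 * (2 * s)).
have v0 : 0 <= v by rewrite divr_ge0 ?sqr_ge0//; lra.
have -> : y ^+ 2 / (4 * s) = v + v by rewrite /v; field; lra.
rewrite opprD expRD mulrA ler_wpM2r ?expR_ge0//.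
rewrite expRN ler_pdivrMr ?expR_gt0//.
apply: (@le_trans _ _ ((1 + 8 * s) * (1 + v))); last first.
  by rewrite ler_wpM2l ?expR_ge1Dx//; lra.
have -> : (1 + 8 * s) * (1 + v) = 1 + 8 * s + v + y ^+ 2.
  by rewrite /v; field; lra.
have := sqr_ge0 (`|y| - 1); rewrite sqrrB expr1n mulr1 real_normK ?num_real//.
by have := sqr_ge0 y; lra.
Qed.
End HeatKernel.

Section FourierHeat.
Context {R : realType}.
Notation mu := (@lebesgue_measure R).
Implicit Types (a c s x y : R).

Lemma integrable_heat_kernel_bounded s x (f : R -> R) : 0 < s ->
  continuous f -> (forall y, `|f y| <= 1) ->
  mu.-integrable setT (EFin \o (fun y => heat_kernel s (x - y) * f y)).
Proof.
move=> s0 cf f1; have intk := integrable_heat_kernel x s0.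
apply: (le_integrable _ _ _ intk) => //.
  apply/measurable_EFinP/measurable_funM.
    by apply/measurable_EFinP; exact: measurable_int intk.
  exact: continuous_measurable_fun.
move=> y _ /=; rewrite lee_fin normrM ler_piMr//.
Qed.

Lemma integrable_heat_kernel_moment s x (f : R -> R) : 0 < s ->
  continuous f -> (forall y, `|f y| <= 1) ->
  mu.-integrable setT
    (EFin \o (fun y => (x - y) * (heat_kernel s (x - y) * f y))).
Proof.
move=> s0 cf f1; have s20 : 0 < 2 * s by lra.
have := integrable_heat_kernel x s20.
move=> /(integrableZl measurableT (Num.sqrt 2 * (1 + 8 * s))) intG.
apply: (le_integrable _ _ _ intG) => //.
  apply/measurable_EFinP/measurable_funM; first exact: measurable_funB.
  apply/measurable_EFinP.
  exact: measurable_int (integrable_heat_kernel_bounded x s0 cf f1).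
move=> y _; rewrite -EFinM !abse_EFin lee_fin; apply: (le_trans _ (ler_norm _)).
apply: le_trans (heat_kernel_moment _ s0).
rewrite (normrM (x - y)) (normrM (heat_kernel s (x - y))) ler_wpM2l//.
by rewrite (ger0_norm (heat_kernel_ge0 _ _)) ler_piMr// heat_kernel_ge0.
Qed.

Lemma heat_kernel_cvg0 s : 0 < s -> heat_kernel s n%:R @[n --> \oo] --> 0.
Proof.
move=> s0; rewrite /heat_kernel -(mulr0 (Num.sqrt (4 * pi * s))^-1).
apply: cvgMl_tmp.
apply: (cvg_comp (fun n : nat => n%:R)
  (fun v => expR (- (v ^+ 2 / (4 * s)))) (@cvgr_idn R)).
apply: (cvg_comp (fun v => v ^+ 2 / (4 * s)) (fun v => expR (- v))).
  by apply: gt0_cvgMly (@cvgr_expr2 R); rewrite invr_gt0; lra.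
exact: cvgr_expR.
Qed.

Lemma is_derive_heat_kernel_sin s x y a c : 0 < s ->
  is_derive y 1
    (fun y => 2 * s * (heat_kernel s (x - y) * sin (a * (y - x) + c)))
    ((x - y) * (heat_kernel s (x - y) * sin (a * (y - x) + c)) +
     2 * s * a * (heat_kernel s (x - y) * cos (a * (y - x) + c))).
Proof.
move=> s0; have dk := is_derive_heat_kernel x y s0.
have ds : is_derive y 1 (fun y => sin (a * (y - x) + c))
                        (a * cos (a * (y - x) + c)).
  by apply: is_derive_eq; rewrite /GRing.scale/=; ring.
apply: is_derive_eq; rewrite /GRing.scale/=; field.
by rewrite gt_eqF.
Qed.

Lemma continuous_heat_kernel s x : 0 < s ->
  continuous (fun y => heat_kernel s (x - y)).
Proof.
move=> s0 y; apply/differentiable_continuous/derivable1_diffP.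
exact: (@ex_derive _ _ _ _ _ _ _ (is_derive_heat_kernel x y s0)).
Qed.

(** The Fourier transform of the heat kernel, with a phase [c]. *)
Let J s x c a :=
  \int[mu]_(y in setT) (heat_kernel s (x - y) * cos (a * (y - x) + c)).

(** Differentiation under the integral sign, followed by an integration by
    parts: multiplying the Gaussian by [x - y] amounts to differentiating it. *)
Let dJ s x c a : 0 < s -> is_derive a 1 (J s x c) (- (2 * s * a) * J s x c a).
Proof.
move=> s0.
pose f a y := heat_kernel s (x - y) * cos (a * (y - x) + c).
have ccos a' : continuous (fun y => cos (a' * (y - x) + c)).
  move=> y; apply/differentiable_continuous/derivable1_diffP.
  exact: (@ex_derive _ _ _ _ _ _ _ (is_derive_eq _ (erefl _))).
have csin a' : continuous (fun y => sin (a' * (y - x) + c)).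
  move=> y; apply/differentiable_continuous/derivable1_diffP.
  exact: (@ex_derive _ _ _ _ _ _ _ (is_derive_eq _ (erefl _))).
have cos1 b : `|cos b| <= 1 :> R by rewrite ler_norml cos_geN1 cos_le1.
have sin1 b : `|sin b| <= 1 :> R by rewrite ler_norml sin_geN1 sin_le1.
have df a' y : is_derive a' 1 (f ^~ y)
    ((x - y) * (heat_kernel s (x - y) * sin (a' * (y - x) + c))).
  rewrite /f; apply: is_derive_eq.
  by rewrite /GRing.scale/=; ring.
pose h y := (x - y) * (heat_kernel s (x - y) * sin (a * (y - x) + c)).
have intf a' : mu.-integrable setT (EFin \o f a').
  exact: integrable_heat_kernel_bounded.
have inth : mu.-integrable setT (EFin \o h).
  exact: integrable_heat_kernel_moment.
(* A majorant of the derivative in [a] that does not depend on [a]. *)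
pose G y := `|(x - y) * (heat_kernel s (x - y) * 1)|.
have intG : mu.-integrable setT (EFin \o G).
  apply: integrable_norm; apply: integrable_heat_kernel_moment => //.
    by move=> y; exact: cvg_cst.
  by move=> y; rewrite normr1.
have Gub a' y : `|partial1of2 f a' y| <= G y.
  rewrite /G partial1of2E (@derive_val _ _ _ _ _ _ _ (df a' y)) mulr1.
  rewrite mulrA normrM ler_piMr//.
have aI : `]a - 1, a + 1[%classic a by rewrite /= in_itv/=; lra.
have intf' a' (_ : `]a - 1, a + 1[%classic a') := intf a'.
have der a' y (_ : `]a - 1, a + 1[%classic a') (_ : setT y) :
    derivable (f ^~ y) a' 1.
  exact: (@ex_derive _ _ _ _ _ _ _ (df a' y)).
have Gub' a' y (_ : `]a - 1, a + 1[%classic a') (_ : [set: R] y) := Gub a' y.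
have G0 y : 0 <= G y by exact: normr_ge0.
have Fd := derivable_under_integral measurableT aI intf' der G0 intG Gub'.
have Fv := differentiation_under_integral measurableT aI intf' der G0 intG Gub'.
apply: DeriveDef; first exact: Fd.
rewrite -derive1E {}Fv.
rewrite (_ : \int[mu]_(y in setT) _ = \int[mu]_(y in setT) h y); last first.
  apply: eq_Rintegral => y _.
  by rewrite partial1of2E (@derive_val _ _ _ _ _ _ _ (df a y)).
have intaf : mu.-integrable setT (EFin \o (fun y => 2 * s * a * f a y)).
  exact: (integrableZl measurableT (2 * s * a) (intf a)).
have : \int[mu]_(y in setT) (h y + 2 * s * a * f a y) = 0.
  pose H y := 2 * s * (heat_kernel s (x - y) * sin (a * (y - x) + c)).
  have Hub y : `|H y| <= 2 * s * heat_kernel s (x - y).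
    rewrite normrM ger0_norm; last by lra.
    apply: ler_wpM2l; first by lra.
    rewrite (normrM (heat_kernel _ _)) (ger0_norm (heat_kernel_ge0 _ _)).
    by rewrite ler_piMr ?heat_kernel_ge0.
  have H0 (u : nat -> R) :
      (forall n, heat_kernel s (x - u n) = heat_kernel s n%:R) ->
      H (u n) @[n --> \oo] --> 0.
    move=> uE; apply/norm_cvg0P.
    apply: (@squeeze_cvgr _ _ _ _ (fun=> 0)
      (fun n => 2 * s * heat_kernel s n%:R)).
    - by apply: nearW => n; rewrite normr_ge0 -uE Hub.
    - exact: cvg_cst.
    - by rewrite -(mulr0 (2 * s)); apply: cvgMl_tmp; exact: heat_kernel_cvg0.
  apply: (@Rintegral_derivative_eq0 _ H (fun y => h y + 2 * s * a * f a y) x).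
  - by move=> y; exact: is_derive_heat_kernel_sin.
  - move=> y; apply: cvgD.
      apply: cvgM; first by apply: cvgB; [exact: cvg_cst|exact: cvg_id].
      by apply: cvgM; [exact: continuous_heat_kernel|exact: csin].
    apply: cvgMl_tmp.
    by apply: cvgM; [exact: continuous_heat_kernel|exact: ccos].
  - exact: (integrableD measurableT inth intaf).
  - by apply: (H0 (fun n => x - n%:R)) => n; rewrite subKr.
  - apply: (H0 (fun n => x + n%:R)) => n.
    by rewrite opprD addNKr /heat_kernel sqrrN.
rewrite (RintegralD measurableT inth intaf) RintegralZl//.
by move=> /eqP; rewrite addr_eq0 => /eqP ->; rewrite /J /f mulNr.
Qed.

Lemma heat_kernel_cos s x c : 0 < s ->
  \int[mu]_(y in setT) (heat_kernel s (x - y) * cos (y + c)) =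
  expR (- s) * cos (x + c).
Proof.
(* [E] is constant, and the integral is [J] at the frequency 1. *)
move=> s0; pose E a := expR (s * a ^+ 2) * J s x (x + c) a.
have dE a : is_derive a 1 E 0.
  have dJa := dJ x (x + c) a s0.
  by apply: is_derive_eq; rewrite /GRing.scale/=; ring.
have := is_derive_0_is_cst 1 0 dE.
rewrite /E expr1n expr0n mulr0 mulr1 expR0 mul1r => E10.
have -> : cos (x + c) = J s x (x + c) 0.
  rewrite /J -[LHS]mul1r -(Rintegral_heat_kernel x s0) -RintegralZr//.
    by apply: eq_Rintegral => y _; rewrite mul0r add0r.
  exact: integrable_heat_kernel.
rewrite -E10 mulrA -expRD addNr expR0 mul1r.
by apply: eq_Rintegral => y _; congr (_ * cos _); ring.
Qed.
End FourierHeat.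

(** * Products of cosines and their heat flow *)

Section CosineProduct.
Context {R : realType} {N : nat}.
Implicit Types (c : 'I_N -> R) (z : 'rV[R]_N) (i k : 'I_N).

(** The product of cosines with phases [c]; all its iterated partial
    derivatives are of the same form. *)
Definition cosprod c z : R := \prod_i cos (z 0 i + c i).

(** The effect on the phases of the partial derivative in coordinate [i]. *)
Definition bump_phase c i : 'I_N -> R :=
  fun j => if j == i then c j + pi / 2 else c j.

Lemma bounded_near_le {T : Type} (f : T -> R) (A : set T) (B : R) :
  (forall p, A p -> `|f p| <= B) -> [bounded f p | p in A].
Proof.
move=> fB; rewrite /bounded_near; near=> M => p Ap /=.
by apply: (le_trans (fB _ Ap)); near: M; exact: nbhs_pinfty_ge (num_real _).
Unshelve. all: by end_near. Qed.

(** A directional derivative is the derivative at 0 along a line. *)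
Lemma is_derive_line (f : 'rV[R]_N -> R) z v (df : R) :
  is_derive (0 : R) 1 (fun h : R => f (h *: v + z)) df -> is_derive z v f df.
Proof.
move=> [df1 df2].
have E : (fun h : R => h^-1 *:
      (((fun h : R => f (h *: v + z)) \o shift 0) (h *: 1) - f (0 *: v + z))) =
    (fun h : R => h^-1 *: ((f \o shift z) (h *: v) - f z)).
  by apply/funext => h /=; rewrite addr0 scale0r add0r /GRing.scale/= mulr1.
by split; [rewrite /derivable -E|rewrite /derive -E].
Qed.

Lemma cosprodE c z k :
  cosprod c z = cos (z 0 k + c k) * \prod_(i | i != k) cos (z 0 i + c i).
Proof. by rewrite /cosprod (bigD1 k). Qed.

Lemma is_derive_cosprod c z i :
  is_derive z (delta_mx 0 i) (cosprod c) (cosprod (bump_phase c i) z).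
Proof.
apply: is_derive_line.
pose P := \prod_(j | j != i) cos (z 0 j + c j).
rewrite (_ : (fun h : R => _) = (fun h : R => cos (h + z 0 i + c i) * P)).
  apply: is_derive_eq.
  rewrite (cosprodE _ _ i) /bump_phase eqxx addrA cosDpihalf add0r.
  rewrite /GRing.scale/= addr0 addr0 mulr1 mulr0 add0r mulrC; congr (_ * _).
  by apply: eq_bigr => j /negPf ->.
apply/funext => h; rewrite (cosprodE _ _ i) !mxE !eqxx mulr1; congr (_ * _).
by apply: eq_bigr => j /negPf ji; rewrite !mxE ji mulr0 add0r.
Qed.

Lemma partial_cosprod c i : partial i (cosprod c) = cosprod (bump_phase c i).
Proof.
apply/funext => z.
by rewrite /partial (@derive_val _ _ _ _ _ _ _ (is_derive_cosprod c z i)).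
Qed.

Lemma partial2_cosprod c i z :
  partial i (partial i (cosprod c)) z = - cosprod c z.
Proof.
rewrite !partial_cosprod !(cosprodE _ _ i) /bump_phase eqxx.
rewrite 2!addrA !cosDpihalf sinDpihalf mulNr; congr (- (_ * _)).
by apply: eq_bigr => j /negPf ->.
Qed.

Lemma continuous_cos_phase (b : R) : continuous (fun x : R => cos (x + b)).
Proof.
move=> x; apply: (continuous_comp (f := fun x => x + b)).
  by apply: cvgD; [exact: cvg_id|exact: cvg_cst].
exact: continuous_cos.
Qed.

Lemma continuous_cosprod c : continuous (cosprod c).
Proof.
apply: continuous_big; first exact: mul_continuous.
move=> i _ z; apply: (@continuous_comp _ _ _ (fun z : 'rV[R]_N => z 0 i)
  (fun x => cos (x + c i))).
  exact: coord_continuous.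
exact: continuous_cos_phase.
Qed.

Lemma normr_cosprod_le1 c z : `|cosprod c z| <= 1.
Proof.
rewrite normr_prod; apply: prodr_ile1 => i.
by rewrite normr_ge0 ler_norml cos_geN1 cos_le1.
Qed.

Lemma supnorm_cosprod (C : R) c : supnorm (fun z => C * cosprod c z) = `|C|.
Proof.
have ubC : ubound [set `|C * cosprod c z| | z in [set: 'rV[R]_N]] `|C|.
  by move=> _ [z _ <-]; rewrite normrM ler_piMr ?normr_cosprod_le1.
have memC : [set `|C * cosprod c z| | z in [set: 'rV[R]_N]] `|C|.
  exists (\row_i - c i) => //; rewrite /cosprod big1 ?mulr1// => i _.
  by rewrite mxE addNr cos0.
apply/le_anti/andP; split; first by apply: ge_sup => //; exists `|C|.
by apply: ub_le_sup => //; exists `|C|.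
Qed.

Lemma partials_cosprod c (s : seq 'I_N) :
  exists c', partials s (cosprod c) = cosprod c'.
Proof.
elim: s => [|i s [c' IH]]; first by exists c.
by exists (bump_phase c' i); rewrite /= IH partial_cosprod.
Qed.

Lemma mderiv_cosprod c (a : 'I_N -> nat) :
  exists c', mderiv a (cosprod c) = cosprod c'.
Proof.
rewrite /mderiv; elim: (enum 'I_N) => [|i s [c' /= ->]]; first by exists c.
elim: (a i) => [|n [c'' /= ->]]; first by exists c'.
by exists (bump_phase c'' i); rewrite partial_cosprod.
Qed.

Lemma supnorm_mderiv_cosprod c (a : 'I_N -> nat) :
  supnorm (mderiv a (cosprod c)) = 1.
Proof.
have [c' ->] := mderiv_cosprod c a.
rewrite -[RHS]normr1 -(supnorm_cosprod 1 c').
by congr supnorm; apply/funext => z; rewrite mul1r.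
Qed.

Lemma smooth_bounded_cosprod c : smooth_bounded (cosprod c).
Proof.
move=> s; have [c' ->] := partials_cosprod c s; split.
- by move=> i z; exact: (@ex_derive _ _ _ _ _ _ _ (is_derive_cosprod c' z i)).
- exact: continuous_cosprod.
- by apply: (@bounded_near_le _ _ _ 1) => z _; exact: normr_cosprod_le1.
Qed.

Lemma heat_conv_cosprod k (s C : R) c : 0 <= s ->
  heat_conv k s (fun z => C * cosprod c z) =
  fun z => expR (- s) * C * cosprod c z.
Proof.
rewrite le_eqVlt => /predU1P[<-|s0]; apply/funext => z; rewrite /heat_conv.
  by rewrite ltxx oppr0 expR0 mul1r.
rewrite s0 (cosprodE c z k); set P := \prod_(i | _) _.
transitivity (\int[lebesgue_measure]_(y in [set: R])
    (heat_kernel s (z 0 k - y) * cos (y + c k) * (C * P))).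
  apply: eq_Rintegral => y _; rewrite (cosprodE c _ k) mxE eqxx.
  rewrite (_ : \prod_(i | i != k) _ = P); first by ring.
  by apply: eq_bigr => i /negPf ik; rewrite mxE ik.
rewrite RintegralZr//.
  by rewrite heat_kernel_cos//; ring.
apply: integrable_heat_kernel_bounded => //.
  exact: continuous_cos_phase.
by move=> y; rewrite ler_norml cos_geN1 cos_le1.
Qed.

Lemma heat_flow_cosprod (lam : 'rV[R]_N) (nu : {set 'I_N}) c (t : R) :
  (forall i, 0 <= lam 0 i) -> 0 <= t ->
  heat_flow lam (cosprod c) nu t =
  fun z => expR (- (\sum_(k in nu) lam 0 k * t)) * cosprod c z.
Proof.
move=> lam0 t0; rewrite /heat_flow -big_enum/=.
elim: (enum nu) => [|k s IH] /=.
  by rewrite big_nil oppr0 expR0; apply/funext => z; rewrite mul1r.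
rewrite IH heat_conv_cosprod ?mulr_ge0// big_cons.
by apply/funext => z; rewrite opprD expRD.
Qed.

(** Since [cosprod c] is an eigenfunction of each second derivative with
    eigenvalue [-1], its heat flow is an exponential decay. *)
Lemma heat_solution_cosprod (T : R) (lam : 'rV[R]_N) (nu : {set 'I_N}) c :
  (forall i, 0 <= lam 0 i) ->
  heat_solution T lam nu (cosprod c) (heat_flow lam (cosprod c) nu).
Proof.
move=> lam0; set L := \sum_(k in nu) lam 0 k.
have L0 : 0 <= L by exact: sumr_ge0.
have uE t z : 0 <= t ->
    heat_flow lam (cosprod c) nu t z = expR (- (L * t)) * cosprod c z.
  by move=> t0; rewrite heat_flow_cosprod// -mulr_suml.
split.
- by apply/funext => z; rewrite uE// mulr0 oppr0 expR0 mul1r.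
- apply: (@subspace_eq_continuous _ _ _
      (fun p : R * 'rV[R]_N => expR (- (L * p.1)) * cosprod c p.2)).
    by move=> p; rewrite inE /= => /andP[p0 _]; rewrite /from_subspace uE.
  apply: continuous_subspaceT => p.
  apply: cvgM.
    apply: (@continuous_comp _ _ _ fst (fun t => expR (- (L * t)))).
      exact: cvg_fst.
    apply/differentiable_continuous/derivable1_diffP.
    exact: (@ex_derive _ _ _ _ _ _ _ (is_derive_eq _ (erefl _))).
  apply: (@continuous_comp _ _ _ snd (cosprod c)); first exact: cvg_snd.
  exact: continuous_cosprod.
- apply: (@bounded_near_le _ _ _ 1) => p /= /andP[p0 _]; rewrite uE//.
  rewrite normrM (ger0_norm (expR_ge0 _)).
  rewrite mulr_ile1 ?expR_ge0 ?normr_cosprod_le1//.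
  by rewrite -expR0 ler_expR oppr_le0 mulr_ge0.
move=> t z /andP[t0 _].
have du : is_derive t 1 (fun s => heat_flow lam (cosprod c) nu s z)
    (- L * (expR (- (L * t)) * cosprod c z)).
  apply: (@near_eq_is_derive _ _ _ (fun s => expR (- (L * s)) * cosprod c z)).
    near=> s; rewrite uE//; apply: ltW; near: s; exact: lt_nbhsr.
  by apply: is_derive_eq; rewrite /GRing.scale/=; ring.
pose E := expR (- (L * t)).
have -> : heat_flow lam (cosprod c) nu t = fun z => E * cosprod c z.
  by apply/funext => y; rewrite uE ?ltW.
have dE c' y k : is_derive y (delta_mx 0 k) (fun z => E * cosprod c' z)
    (E * cosprod (bump_phase c' k) y).
  have := is_derive_cosprod c' y k => ?.
  by apply: is_derive_eq; rewrite /GRing.scale/=; ring.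
have partialE c' k : partial k (fun z => E * cosprod c' z) =
    fun z => E * cosprod (bump_phase c' k) z.
  apply/funext => y.
  by rewrite /partial (@derive_val _ _ _ _ _ _ _ (dE c' y k)).
split.
- exact: (@ex_derive _ _ _ _ _ _ _ du).
- move=> k _; rewrite partialE; split.
    exact: (@ex_derive _ _ _ _ _ _ _ (dE c z k)).
  exact: (@ex_derive _ _ _ _ _ _ _ (dE (bump_phase c k) z k)).
rewrite derive1E (@derive_val _ _ _ _ _ _ _ du) -/E.
rewrite mulNr -mulrN /L mulr_suml; apply: eq_bigr => k _.
by rewrite !partialE -!partial_cosprod partial2_cosprod !mulrN.
Unshelve. all: by end_near. Qed.

End CosineProduct.

(** * Elementary symmetric polynomials *)

Section ElementarySymmetric.
Context {R : realType}.

(** The elementary symmetric polynomial of degree [m], as a sum over the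
    multi-indices with entries 0 and 1. *)
Definition esym {N : nat} (m : nat) (y : 'rV[R]_N) : R :=
  \sum_(a : {ffun 'I_N -> 'I_2} | (\sum_i a i)%N == m) mpow y (fun i => a i).

(** The sum of the elementary symmetric polynomials of degree at least [m]. *)
Definition esym_tail {N : nat} (m : nat) (y : 'rV[R]_N) : R :=
  \sum_(a : {ffun 'I_N -> 'I_2} | (m <= \sum_i a i)%N) mpow y (fun i => a i).

Lemma esym_tail_recl N m (y : 'rV[R]_N) :
  esym_tail m y = esym m y + esym_tail m.+1 y.
Proof.
rewrite /esym_tail.
rewrite (bigID (fun a : {ffun 'I_N -> 'I_2} => (\sum_i a i)%N == m))/=.
congr (_ + _); apply: eq_bigl => a; last by rewrite ltn_neqAle andbC eq_sym.
by case: eqP => [->|_]; rewrite ?leqnn ?andbF.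
Qed.

Lemma prod_esym N (y : 'rV[R]_N) :
  \prod_i (1 + y 0 i *: 'X) =
  \sum_(a : {ffun 'I_N -> 'I_2}) mpow y (fun i => a i) *: 'X^(\sum_i a i)
    :> {poly R}.
Proof.
transitivity (\prod_i \sum_(b : 'I_2) y 0 i ^+ b *: 'X^b : {poly R}).
  apply: eq_bigr => i _; rewrite big_ord_recl big_ord1 /=.
  by rewrite expr0 scale1r !expr1.
rewrite bigA_distr_bigA; apply: eq_bigr => a _.
by rewrite scaler_prod prodrXr.
Qed.

Lemma esym_tail0 N (y : 'rV[R]_N) : esym_tail 0 y = \prod_i (1 + y 0 i).
Proof.
transitivity ((\prod_i (1 + y 0 i *: 'X : {poly R})).[1]).
  rewrite prod_esym horner_sum; apply: eq_bigr => a _.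
  by rewrite hornerZ hornerXn expr1n mulr1.
by rewrite horner_prod; apply: eq_bigr => i _; rewrite !hornerE.
Qed.

Lemma coef_prod1D N (y : 'rV[R]_N) m :
  (\prod_i (1 + y 0 i *: 'X : {poly R}))`_m = esym m y.
Proof.
rewrite prod_esym coef_sum /esym [RHS]big_mkcond; apply: eq_bigr => a _.
by rewrite coefZ coefXn eq_sym; case: eqP => _; rewrite ?mulr1 ?mulr0.
Qed.

(** Newton's identities in degree at most 2. *)
Lemma low_coef_prod1D (I : Type) (s : seq I) (y : I -> R) :
  let p : {poly R} := \prod_(i <- s) (1 + y i *: 'X) in
  [/\ p`_0 = 1, p`_1 = \sum_(i <- s) y i &
      2 * p`_2 = (\sum_(i <- s) y i) ^+ 2 - \sum_(i <- s) y i ^+ 2].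
Proof.
elim: s => [|i s [c0 c1 c2]] /=.
  by rewrite !big_nil !coef1/=; split=> //; ring.
rewrite !big_cons mulrDl mul1r -scalerAl !coefD !coefZ !coefXM /= c0 c1; split.
- by rewrite mulr0 addr0.
- by rewrite mulr1 addrC.
- by rewrite mulrDr c2; ring.
Qed.

Lemma esym0 N (y : 'rV[R]_N) : esym 0 y = 1.
Proof.
by rewrite -coef_prod1D; case: (low_coef_prod1D (index_enum 'I_N) (y 0)).
Qed.

Lemma esym1 N (y : 'rV[R]_N) : esym 1 y = \sum_i y 0 i.
Proof.
by rewrite -coef_prod1D; case: (low_coef_prod1D (index_enum 'I_N) (y 0)).
Qed.

Lemma esym2 N (y : 'rV[R]_N) :
  2 * esym 2 y = (\sum_i y 0 i) ^+ 2 - \sum_i y 0 i ^+ 2.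
Proof.
by rewrite -coef_prod1D; case: (low_coef_prod1D (index_enum 'I_N) (y 0)).
Qed.

Lemma sum_lt_pairs N (w : 'I_N -> R) :
  2 * (\sum_(k < N) \sum_(l : 'I_N | (k < l)%N) w k * w l) =
  (\sum_k w k) ^+ 2 - \sum_k w k ^+ 2.
Proof.
have lt_gt : \sum_(k < N) \sum_(l : 'I_N | (l < k)%N) w k * w l =
             \sum_(k < N) \sum_(l : 'I_N | (k < l)%N) w k * w l.
  rewrite (exchange_big_dep predT)//=; apply: eq_bigr => k _.
  by apply: eq_bigr => l _; rewrite mulrC.
have -> : (\sum_k w k) ^+ 2 =
    \sum_(k < N) \sum_(l : 'I_N | (k < l)%N) w k * w l +
    (\sum_k w k ^+ 2 + \sum_(k < N) \sum_(l : 'I_N | (l < k)%N) w k * w l).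
  rewrite expr2 mulr_suml -!big_split/=; apply: eq_bigr => k _.
  rewrite mulr_sumr (bigID (fun l : 'I_N => (k < l)%N))/=; congr (_ + _).
  rewrite (bigD1 k) ?ltnn//=; congr (_ + _); apply: eq_bigl => l.
  by rewrite -leqNgt ltn_neqAle andbC.
by rewrite lt_gt; ring.
Qed.

Lemma mpow0 N (a : 'I_N -> nat) :
  (0 < \sum_i a i)%N -> mpow (0 : 'rV[R]_N) a = 0.
Proof.
rewrite lt0n sum_nat_eq0 negb_forall => /existsP[i]; rewrite implyTb => ai.
by rewrite /mpow (bigD1 i)//= mxE expr0n (negPf ai) mul0r.
Qed.

Lemma mpowZ N (b : R) (y : 'rV[R]_N) (a : 'I_N -> nat) :
  mpow (b *: y) a = b ^+ (\sum_i a i) * mpow y a.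
Proof.
rewrite /mpow -prodrXr -big_split/=.
by apply: eq_bigr => i _; rewrite mxE exprMn.
Qed.

Lemma esymZ N m (b : R) (y : 'rV[R]_N) : esym m (b *: y) = b ^+ m * esym m y.
Proof. by rewrite mulr_sumr; apply: eq_bigr => a /eqP am; rewrite mpowZ am. Qed.

Lemma esym_ge0 N m (y : 'rV[R]_N) :
  (forall i, 0 <= y 0 i) -> 0 <= esym m y.
Proof.
move=> y0; apply: sumr_ge0 => a _.
by apply: prodr_ge0 => i _; exact: exprn_ge0.
Qed.

(** Only the terms of lowest degree survive in the limit. *)
Lemma esym_tail_cvg N m (y : R -> 'rV[R]_N) (d : 'rV[R]_N) :
  (forall i, t^-1 * y t 0 i @[t --> 0^'+] --> d 0 i) ->
  t ^- m * esym_tail m (y t) @[t --> 0^'+] --> esym m d.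
Proof.
move=> yd.
rewrite /esym (eq_bigl (fun a : {ffun 'I_N -> 'I_2} =>
   (m <= \sum_i a i)%N && ((\sum_i a i)%N == m))); last first.
  by move=> a; case: eqP => [->|]; rewrite ?leqnn ?andbF.
rewrite big_mkcondr/=.
rewrite /esym_tail; under eq_fun do rewrite mulr_sumr.
apply: cvg_big; first exact: add_continuous.
move=> a ma.
have cvg_a : mpow (t^-1 *: y t) (fun i => a i) @[t --> 0^'+] -->
    mpow d (fun i => a i).
  apply: cvg_big; first exact: mul_continuous.
  move=> i _.
  under eq_fun do rewrite mxE.
  exact: (cvg_comp _ (fun x => x ^+ a i) (yd i) (@exprn_continuous _ _ _)).
(* The term is [t ^+ (|a| - m)] times [mpow (t^-1 *: y t) a]. *)
have -> : (if (\sum_i a i)%N == m then mpow d (fun i => a i) else 0) =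
   0 ^+ (\sum_i a i - m) * mpow d (fun i => a i).
  rewrite expr0n subn_eq0 (eqn_leq _ m) ma andbT.
  by case: ifP; rewrite ?mul1r ?mul0r.
apply: cvg_trans (cvgM _ cvg_a); last first.
  exact: (cvg_at_right_filter (@exprn_continuous R _ 0)).
apply: near_eq_cvg; near=> t.
have t0 : t != 0 by rewrite gt_eqF//; near: t; exact: nbhs_right_gt.
rewrite /= mpowZ mulrA exprVn -[in X in _ * X^-1](subnK ma) exprD invfM.
by rewrite mulrA divff ?mul1r ?expf_neq0.
Unshelve. all: by end_near. Qed.

End ElementarySymmetric.

(** * The error of the expansions *)

Section Expansion.
Context {R : realType} {N : nat}.
Variables (r : nat) (lam : 'rV[R]_N) (t : R).
Implicit Types (c : 'I_N -> R).

Let dlam := lam - lam0 r lam.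

(** The relative change of the solution caused by diffusion in each of the
    coordinates from [r] on; its other entries are 0. *)
Definition decrement : 'rV[R]_N := \row_k (expR (- (dlam 0 k * t)) - 1).

(** The decay caused by the first [r] coordinates, which is common to the
    solution and to all terms of its expansions. *)
Definition head_decay : R := expR (- (\sum_(k in head_set N r) lam 0 k * t)).

Let decrement_head (k : 'I_N) : (k < r)%N -> decrement 0 k = 0.
Proof. by move=> kr; rewrite !mxE kr subrr mul0r oppr0 expR0 subrr. Qed.

Let decrement_tail (k : 'I_N) :
  (r <= k)%N -> expR (- (lam 0 k * t)) = 1 + decrement 0 k.
Proof. by move=> kr; rewrite !mxE ltnNge kr subr0 addrC subrK. Qed.

Let notin_head (k : 'I_N) : (r <= k)%N -> k \notin head_set N r.
Proof. by rewrite inE -leqNgt. Qed.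

Lemma decay_setU1 (k : 'I_N) : (r <= k)%N ->
  expR (- (\sum_(i in k |: head_set N r) lam 0 i * t)) =
  head_decay * (1 + decrement 0 k).
Proof.
move=> kr; rewrite big_setU1 ?notin_head//= opprD expRD mulrC.
by rewrite decrement_tail.
Qed.

Lemma decay_setU2 (k l : 'I_N) : (r <= k)%N -> (k < l)%N ->
  expR (- (\sum_(i in k |: (l |: head_set N r)) lam 0 i * t)) =
  head_decay * ((1 + decrement 0 k) * (1 + decrement 0 l)).
Proof.
move=> kr kl; have lr := leq_trans kr (ltnW kl).
rewrite big_setU1/=; last first.
  by rewrite !inE negb_or -val_eqE ltn_eqF//= -leqNgt.
rewrite opprD expRD decay_setU1// decrement_tail//; ring.
Qed.

Lemma decay_setT :
  expR (- (\sum_(i in [set: 'I_N]%SET) lam 0 i * t)) =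
  head_decay * \prod_k (1 + decrement 0 k).
Proof.
rewrite (bigID (mem (head_set N r)))/= opprD expRD; congr (expR (- _) * _).
  by apply: eq_bigl => i; rewrite inE.
rewrite [RHS](bigID (mem (head_set N r)))/=.
rewrite [X in _ = X * _]big1 ?mul1r; last first.
  by move=> k; rewrite inE => kr; rewrite decrement_head// addr0.
rewrite -sumrN expR_sum; apply: eq_big => [k|k]; rewrite !inE//=.
by rewrite -leqNgt => kr; rewrite decrement_tail.
Qed.

Let sum_tail (f : 'I_N -> R) : (forall k : 'I_N, (k < r)%N -> f k = 0) ->
  \sum_(k < N | (r <= k)%N) f k = \sum_k f k.
Proof.
move=> f0; rewrite [RHS](bigID (fun k : 'I_N => (r <= k)%N))/=.
by rewrite [X in _ + X]big1 ?addr0// => k; rewrite -ltnNge; exact: f0.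
Qed.

Lemma sum_tail1 : (r <= N)%N -> \sum_(k < N | (r <= k)%N) 1 = N%:R - r%:R :> R.
Proof.
move=> rN; rewrite -natrB// -(sumr_const_nat N r) big_geq_mkord.
by apply: eq_bigl => k.
Qed.

(** The expansion of order [m] reproduces exactly the part of degree at most
    [m] in the decrements. *)
Lemma expansion_error m (z : 'rV[R]_N) c : (r <= N)%N ->
  (forall i, 0 <= lam 0 i) -> 0 <= t -> m = 1%N \/ m = 2%N ->
  heat_flow lam (cosprod c) [set: 'I_N]%SET t z -
    expansion m r (heat_flow lam (cosprod c)) t z =
  head_decay * esym_tail m.+1 decrement * cosprod c z.
Proof.
move=> rN lam_ge0 t0 hm; set g := cosprod c z; set y := decrement.
have uE nu : heat_flow lam (cosprod c) nu t z =
    expR (- (\sum_(k in nu) lam 0 k * t)) * g by rewrite heat_flow_cosprod.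
have sum1 : \sum_(k < N | (r <= k)%N)
      heat_flow lam (cosprod c) (k |: head_set N r)%SET t z =
    head_decay * (N%:R - r%:R + esym 1 y) * g.
  transitivity (\sum_(k < N | (r <= k)%N) head_decay * (1 + y 0 k) * g).
    by apply: eq_bigr => k kr; rewrite uE decay_setU1.
  by rewrite -mulr_suml -mulr_sumr big_split/= sum_tail1// esym1 sum_tail.
have tail0 := esym_tail0 y; rewrite 3!esym_tail_recl esym0 in tail0.
have uT : heat_flow lam (cosprod c) [set: 'I_N]%SET t z =
    head_decay * (1 + (esym 1 y + (esym 2 y + esym_tail 3 y))) * g.
  by rewrite uE decay_setT -tail0.
rewrite uT; case: hm => ->.
  rewrite /expansion /= /expansion1 sum1 uE -/head_decay (esym_tail_recl 2).
  ring.
have sum2 : \sum_(k < N | (r <= k)%N) \sum_(l < N | (k < l)%N)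
      heat_flow lam (cosprod c) (k |: (l |: head_set N r))%SET t z =
    head_decay * (((N%:R - r%:R) ^+ 2 - (N%:R - r%:R)) / 2
      + (N%:R - r%:R - 1) * esym 1 y + esym 2 y) * g.
  (* Extending the factors by 0 turns the sum into one over all pairs. *)
  pose w (k : 'I_N) : R := if (r <= k)%N then 1 + y 0 k else 0.
  have whead (k : 'I_N) : (k < r)%N -> w k = 0.
    by rewrite /w ltnNge => /negPf ->.
  transitivity (\sum_(k < N) \sum_(l < N | (k < l)%N)
      head_decay * (w k * w l) * g).
    rewrite -sum_tail; last first.
      by move=> k /whead ->; rewrite big1// => l _; rewrite mul0r mulr0 mul0r.
    apply: eq_bigr => k kr; apply: eq_bigr => l kl.
    by rewrite uE decay_setU2// /w kr (leq_trans kr (ltnW kl)).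
  transitivity
      (head_decay * (\sum_(k < N) \sum_(l < N | (k < l)%N) w k * w l) * g).
    rewrite mulr_sumr mulr_suml; apply: eq_bigr => k _.
    by rewrite mulr_sumr mulr_suml.
  have nz2 : (2 : R) != 0 by rewrite pnatr_eq0.
  rewrite -[X in _ * X * _](mulKf nz2) sum_lt_pairs.
  have -> : \sum_k w k = N%:R - r%:R + esym 1 y.
    rewrite -sum_tail// (eq_bigr (fun k => 1 + y 0 k)); last first.
      by move=> k kr; rewrite /w kr.
    by rewrite big_split/= sum_tail1// esym1 sum_tail.
  have -> : \sum_k w k ^+ 2 = N%:R - r%:R + 2 * esym 1 y + \sum_k y 0 k ^+ 2.
    rewrite -sum_tail; last by move=> k /whead ->; rewrite expr0n.
    rewrite (eq_bigr (fun k => 1 + 2 * y 0 k + y 0 k ^+ 2)); last first.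
      by move=> k kr; rewrite /w kr; ring.
    rewrite !big_split/= sum_tail1// esym1 -mulr_sumr.
    by rewrite !sum_tail// => k kr; rewrite decrement_head// expr0n.
  have := esym2 y; rewrite -esym1 => E2.
  have -> : \sum_k y 0 k ^+ 2 = esym 1 y ^+ 2 - 2 * esym 2 y.
    by rewrite E2; ring.
  by field.
by rewrite /expansion /= /expansion2 sum1 sum2 uE -/head_decay; field.
Qed.

End Expansion.

Section ErrorLimit.
Context {R : realType} {N : nat}.
Variables (r : nat) (lam : 'rV[R]_N).

Let dlam := lam - lam0 r lam.

Lemma is_derive_expR_at0 (L : R) :
  is_derive (0 : R) 1 (fun t : R => expR (- (L * t))) (- L).
Proof.
by apply: is_derive_eq; rewrite /GRing.scale/= mulr0 oppr0 expR0; ring.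
Qed.

Lemma decrement_cvg k :
  t^-1 * decrement r lam t 0 k @[t --> 0^'+] --> (- dlam) 0 k.
Proof.
have [d1 d2] := is_derive_expR_at0 (dlam 0 k).
have : (fun h : R => h^-1 * (expR (- (dlam 0 k * h)) - 1)) t @[t --> 0^'] -->
    - dlam 0 k.
  rewrite -d2; move: d1; rewrite /derivable /derive.
  rewrite (_ : (fun h => h^-1 *: _) =
    (fun h : R => h^-1 * (expR (- (dlam 0 k * h)) - 1)))//.
  by apply/funext => h /=; rewrite addr0 mulr0 oppr0 expR0 /GRing.scale/= mulr1.
move=> /cvg_dnbhs_at_right lim; rewrite mxE.
by under eq_fun do rewrite mxE.
Qed.

Lemma head_decay_cvg : head_decay r lam t @[t --> 0^'+] --> (1 : R).
Proof.
rewrite /head_decay; under eq_fun do rewrite -mulr_suml.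
have [/derivable1_diffP/differentiable_continuous c _] :=
  is_derive_expR_at0 (\sum_(k in head_set N r) lam 0 k).
have := cvg_at_right_filter c.
by rewrite mulr0 oppr0 expR0.
Qed.

Lemma error_coef_cvg m :
  t ^- m * (head_decay r lam t * esym_tail m (decrement r lam t)) @[t --> 0^'+]
  --> (-1) ^+ m * esym m dlam.
Proof.
rewrite -esymZ scaleN1r -[X in _ --> X]mul1r.
under eq_fun do rewrite mulrCA.
apply: cvgM head_decay_cvg _.
by apply: esym_tail_cvg => i; exact: decrement_cvg.
Qed.

Lemma decrement_eq0 t : dlam = 0 -> decrement r lam t = 0.
Proof.
move=> d0; apply/rowP => k.
by rewrite mxE -/dlam d0 !mxE mul0r oppr0 expR0 subrr.
Qed.

End ErrorLimit.

Lemma eucl_norm_gt0 (R : realType) (N : nat) (v : 'rV[R]_N) :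
  v != 0 -> 0 < eucl_norm v.
Proof.
move=> v0; have [i vi] : exists i, v 0 i != 0.
  apply/existsP; apply: contraR v0; rewrite negb_exists => /forallP v0.
  by apply/eqP/rowP => i; rewrite mxE; apply/eqP; rewrite -[_ == _]negbK.
rewrite sqrtr_gt0 (bigD1 i)//= ltr_pwDl ?exprn_even_gt0//.
by apply: sumr_ge0 => j _; exact: sqr_ge0.
Qed.

Theorem mainTheorem4 (R : realType) (N r m : nat) (lam : 'rV[R]_N) (T : R)
  (hr : (r <= N)%N) (hm : m = 1%N \/ m = 2%N) (hT : 0 < T)
  (lam_ge0 : forall i : 'I_N, 0 <= lam 0 i)
  (lam_mono : forall i j : 'I_N, (i <= j)%N -> lam 0 j <= lam 0 i) :
  exists g : 'rV[R]_N -> R,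
    let u := heat_flow lam g in
    let dlam := lam - lam0 r lam in
    [/\ smooth_bounded g,
        forall a : {ffun 'I_N -> 'I_2}, (\sum_i a i)%N = m.+1 ->
          0 < supnorm (mderiv (fun i => (2 * a i)%N) g),
        forall nu : {set 'I_N}, heat_solution T lam nu g (u nu)
      & (fun t : R =>
           supnorm (fun z => u [set: 'I_N]%SET t z - expansion m r u t z))
        = (fun t : R => t ^+ m.+1 *
             \sum_(a : {ffun 'I_N -> 'I_2} | (\sum_i a i)%N == m.+1)
               mpow dlam (fun i => a i)
               * supnorm (mderiv (fun i => (2 * a i)%N) g))
        +o_ (0^'+) (fun t : R => t ^+ m.+1 * eucl_norm dlam ^+ m.+1)].
Proof.
exists (cosprod (fun=> 0)) => u dlam.
split.
- exact: smooth_bounded_cosprod.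
- by move=> a _; rewrite supnorm_mderiv_cosprod.
- by move=> nu; exact: heat_solution_cosprod.
have supE t : 0 < t ->
    supnorm (fun z => u [set: 'I_N]%SET t z - expansion m r u t z) =
    `|head_decay r lam t * esym_tail m.+1 (decrement r lam t)|.
  move=> t0; rewrite -(@supnorm_cosprod _ N _ (fun=> 0)); congr supnorm.
  by apply/funext => z; rewrite expansion_error// ltW.
have sumE : \sum_(a : {ffun 'I_N -> 'I_2} | (\sum_i a i)%N == m.+1)
    mpow dlam (fun i => a i) *
    supnorm (mderiv (fun i => (2 * a i)%N) (cosprod (fun=> 0))) =
    esym m.+1 dlam.
  by apply: eq_bigr => a _; rewrite supnorm_mderiv_cosprod mulr1.
rewrite sumE {sumE}; apply/eqaddoP => e e0 /=.
have esym_ge0 : 0 <= esym m.+1 dlam.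
  apply: esym_ge0 => i; rewrite !mxE; case: ifP; rewrite ?subrr// subr0.
  by rewrite lam_ge0.
have [d0|d0] := eqVneq dlam 0.
  (* Both sides vanish identically. *)
  near=> t; rewrite /= !fctE supE; last by near: t; exact: nbhs_right_gt.
  rewrite (decrement_eq0 _ d0) d0.
  rewrite /esym /esym_tail !big1.
  + by rewrite !mulr0 normr0 subrr normr0 mulr_ge0// ltW.
  + by move=> a /eqP am; rewrite mpow0// am.
  + by move=> a am; rewrite mpow0// (leq_trans _ am).
have K0 : 0 < eucl_norm dlam ^+ m.+1 by rewrite exprn_gt0// eucl_norm_gt0.
have eK : 0 < e * eucl_norm dlam ^+ m.+1 by rewrite mulr_gt0.
have := @error_coef_cvg R N r lam m.+1.
move=> /cvg_norm /cvgrPdist_le /(_ _ eK) near_lim.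
near=> t.
have t0 : 0 < t by near: t; exact: nbhs_right_gt.
have tm0 : 0 < t ^+ m.+1 by rewrite exprn_gt0.
rewrite /= !fctE supE//.
have : `| `|(-1) ^+ m.+1 * esym m.+1 dlam| -
   `|t ^- m.+1 * (head_decay r lam t * esym_tail m.+1 (decrement r lam t))| |
   <= e * eucl_norm dlam ^+ m.+1 by near: t.
rewrite normrM normrX normrN1 expr1n mul1r (ger0_norm esym_ge0).
have tmV0 : 0 < t ^- m.+1 by rewrite invr_gt0.
rewrite (normrM (t ^- _)) (gtr0_norm tmV0).
set F := `|_ * esym_tail _ _| => le_e.
rewrite (gtr0_norm (mulr_gt0 tm0 K0)) mulrCA.
rewrite -(ler_pM2l tm0) in le_e; apply: le_trans le_e.
by rewrite -{2}(gtr0_norm tm0) -normrM mulrBr mulVKf ?gt_eqF// distrC.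
Unshelve. all: by end_near. Qed.
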